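(* Let $G=(\mathcal S,E)$ be a finite connected graph with $N=|\mathcal S|$ vertices and let $\mu=(\mu(s):s\in\mathcal S)$ be a probability distribution on $\mathcal S$ such that the induced subgraph $G[\mathrm{supp}(\mu)]$ is not connected. Let $t_\ell=\ell^{5N}$ for $\ell\in\mathbb N$, and let $X=(X(t):t\in\mathbb N)$ be a non-homogeneous Markov chain on $\mathcal S$, with arbitrary initial distribution $\lambda$, whose transition matrix at time $t$ (from $X(t)$ to $X(t+1)$) is $$P(t)=\sum_{k=1}^{\infty}P^{(\mu_k,G)}\,\mathbf 1_{\{t\in[t_k,t_{k+1})\}}\quad (t\ge 1),\qquad P(0)=P^{(\mu_1,G)},$$ where the distributions $\mu_k$ and the matrices $P^{(\mu_k,G)}$ are those defined in the context. Then $$\lim_{t\to\infty}\frac1t\sum_{m=0}^{t-1}\mathbf 1_{\{X(m)=s\}}=\mu(s)\quad\text{for all } s\in\mathcal S,\quad\text{almost surely.}$$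
   Context: Graphs are finite, simple and undirected; $\mathbb N=\{0,1,2,\dots\}$. $G[\mathcal S']$ denotes the subgraph of $G$ induced by $\mathcal S'\subset\mathcal S$, and $\mathrm{supp}(\mu)=\{s:\mu(s)>0\}$. The distributions $\mu_k$. For $k\ge1$ let $\mathcal A_k=\{s\in\mathcal S:\mu(s)<1/k\}$ (non-empty here, since $G$ is connected and $G[\mathrm{supp}(\mu)]$ is not), let $\eta_k$ be the uniform distribution on $\mathcal A_k$, and let $\mu_k=\frac1k\eta_k+\frac{k-1}{k}\mu$. Under the stated hypotheses $N\ge3$ and $\mu_k(s)>0$ for all $s\in\mathcal S$ and $k\ge1$. The matrices $P^{(\mu_k,G)}$. Label $\mathcal S=\{s^1,\dots,s^N\}$ so that $\mu(s^1)\ge\mu(s^2)\ge\cdots\ge\mu(s^N)$. Define $P^{(\mu_k,G)}=(p_{l,m})_{l,m=1,\dots,N}$ by $$p_{l,m}=\begin{cases}p,& l<m,\ \{s^l,s^m\}\in E,\\ \frac{\mu_k(s^m)}{\mu_k(s^l)}\,p,& l>m,\ \{s^l,s^m\}\in E,\\ p_l,& l=m,\\ 0,&\text{otherwise,}\end{cases}$$ where $$p=\min_{l=1,\dots,N}\frac{1}{2\left(\sum_{m'>l}\mathbf 1_{\{\{s^l,s^{m'}\}\in E\}}+\sum_{m'<l}\frac{\mu_k(s^{m'})}{\mu_k(s^l)}\mathbf 1_{\{\{s^l,s^{m'}\}\in E\}}\right)}$$ and $$p_l=1-p\left[\sum_{m'>l}\mathbf 1_{\{\{s^l,s^{m'}\}\in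 E\}}+\sum_{m'<l}\frac{\mu_k(s^{m'})}{\mu_k(s^l)}\mathbf 1_{\{\{s^l,s^{m'}\}\in E\}}\right].$$ *)

(* Defs.v *)
From HB Require Import structures.
From mathcomp Require Import all_boot all_order all_algebra.
From mathcomp Require Import all_classical all_reals all_analysis.

Set Implicit Arguments.
Unset Strict Implicit.
Unset Printing Implicit Defensive.

Import Order.TTheory GRing.Theory Num.Theory.
Import numFieldNormedType.Exports.

Local Open Scope classical_set_scope.
Local Open Scope ring_scope.

Definition simple_graph (S : finType) (E : rel S) : Prop :=
  symmetric E /\ irreflexive E.

Definition connected_graph (S : finType) (E : rel S) : Prop :=
  (0 < #|S|)%N /\ forall x y : S, connect E x y.

Definition induced_subgraph (S : finType) (E : rel S) (A : {set S}) :
    rel {x : S | x \in A} :=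
  fun u v => E (val u) (val v).
Arguments induced_subgraph {S} E A.

Definition distribution_on (R : realType) (S : finType) (mu : S -> R) : Prop :=
  (forall s, 0 <= mu s) /\ \sum_(s : S) mu s = 1.

Definition supp (R : realType) (S : finType) (mu : S -> R) : {set S} :=
  [set s | 0 < mu s]%SET.

Section Perturbation.
Variables (R : realType) (S : finType) (mu : S -> R) (k : nat).

Definition low_mass : {set S} := [set s | mu s < 1 / k%:R]%SET.

Definition uniform_on (A : {set S}) (s : S) : R :=
  if s \in A then 1 / #|A|%:R else 0.

Definition mu_ (s : S) : R :=
  1 / k%:R * uniform_on low_mass s + (k%:R - 1) / k%:R * mu s.

End Perturbation.

(* The states are listed as s^1, ..., s^N by [lab]; ordinals start at 0, so
   [lab l] is s^(l+1).  [nu] is the target distribution. *)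
Section TransitionMatrix.
Variables (R : realType) (S : finType) (E : rel S).
Variables (lab : 'I_#|S| -> S) (nu : S -> R).

Definition weight (l : 'I_#|S|) : R :=
  \sum_(m : 'I_#|S| | (l < m)%N && E (lab l) (lab m)) 1
  + \sum_(m : 'I_#|S| | (m < l)%N && E (lab l) (lab m))
      nu (lab m) / nu (lab l).

(* The minimum is taken in the extended reals, where +oo is neutral; it is
   finite as soon as S is non-empty. *)
Definition edge_prob : R :=
  fine (\big[Order.min/+oo%E]_(l : 'I_#|S|) (1 / (2 * weight l))%:E).

Definition target_matrix : 'M[R]_#|S| :=
  \matrix_(l, m)
    if l == m then 1 - edge_prob * weight l
    else if E (lab l) (lab m) then
      if (l < m)%N then edge_prob
      else nu (lab m) / nu (lab l) * edge_prob
    else 0.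

End TransitionMatrix.

Definition epoch (S : finType) (l : nat) : nat := (l ^ (5 * #|S|))%N.

(* The sum over all k >= 1 is a finitely supported one: for every t at most one
   window [epoch k, epoch (k+1)) contains t. *)
Definition chain_matrix (R : realType) (S : finType) (E : rel S)
    (lab : 'I_#|S| -> S) (mu : S -> R) (t : nat) : 'M[R]_#|S| :=
  if t == 0%N then target_matrix E lab (mu_ mu 1)
  else \sum_(k \in [set k : nat | (1 <= k)%N])
         (epoch S k <= t < epoch S k.+1)%N%:R *: target_matrix E lab (mu_ mu k).

Definition cond_prob (R : realType) (d : measure_display)
    (Omega : measurableType d) (P : probability Omega R) (A B : set Omega) : R :=
  fine (P (A `&` B)) / fine (P B).

(* [Q t l m] is the probability of moving from [lab l] at time t to [lab m] at
   time t + 1; a history is a sequence of labels [x 0, ..., x t].  The first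
   condition is measurability for the discrete sigma-algebra on S. *)
Definition markov_chain (R : realType) (d : measure_display)
    (Omega : measurableType d) (P : probability Omega R) (S : finType)
    (lab : 'I_#|S| -> S) (lambda : S -> R) (Q : nat -> 'M[R]_#|S|)
    (X : nat -> Omega -> S) : Prop :=
  [/\ forall t s, measurable [set w | X t w = s],
      forall s, P [set w | X 0%N w = s] = (lambda s)%:E
    & forall (t : nat) (x : nat -> 'I_#|S|) (m : 'I_#|S|),
        let past := [set w | forall i, (i <= t)%N -> X i w = lab (x i)] in
        P past != 0%E ->
        cond_prob P [set w | X t.+1 w = lab m] past = Q t (x t) m].

(* Main.v *)
Require Import Defs.
From HB Require Import structures.
From mathcomp Require Import all_boot all_order all_algebra.
From mathcomp Require Import all_classical all_reals all_analysis.
From mathcomp Require Import ring lra.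

Import Order.TTheory GRing.Theory Num.Theory.
Import numFieldNormedType.Exports.

Set Implicit Arguments.
Unset Strict Implicit.
Unset Printing Implicit Defensive.

Local Open Scope classical_set_scope.
Local Open Scope ring_scope.

(* Fix a state s. For each k the Poisson equation (I - P_k) g_k = 1_s - mu_k(s)
   has a solution with |g_k| <= 4 N^3 k^2: in the electrical network of the
   reversible chain P_k, the total current out of a superlevel set of g_k is at
   most 1, hence so is the current through each edge, and every conductance is
   at least of order 1 / k^2. Substituting g_k, the centred occupation time of s
   up to t is a martingale plus a telescoping sum. The telescoping sum only pays
   at the changes of k, so it is O(K(t)^3) where K(t) is the current value of k,
   and the martingale has variance O(t K(t)^4). Since K(t)^10 <= t, the first is
   o(t), and by Chebyshev and Borel-Cantelli the second is o(t) almost surely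
   along t = n^4. Occupation times have bounded increments, which fills the gaps
   between fourth powers, and mu_k(s) tends to mu(s). *)

(** * The Poisson equation of a reversible chain *)

Section Poisson.
Variables (R : realType) (n : nat) (e : rel 'I_n) (nu : 'I_n -> R).
Variables (Q : 'M[R]_n) (c : R).
Hypothesis e_conn : forall x y, connect e x y.
Hypothesis nu_ge0 : forall l, 0 <= nu l.
Hypothesis nu_sum1 : \sum_l nu l = 1.
Hypothesis Q_row1 : forall l, \sum_m Q l m = 1.
Hypothesis Q_rev : forall l m, nu l * Q l m = nu m * Q m l.
Hypothesis Q_ge0 : forall l m, l != m -> 0 <= Q l m.
Hypothesis c_gt0 : 0 < c.
Hypothesis Q_edge : forall l m, e l m -> c <= nu l * Q l m.

(** Reversibility makes the current [F z w] antisymmetric, so the currents inside [A] cancel and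
    only those leaving [A] remain. *)
Lemma superlevel_flow (g : 'I_n -> R) (A : {set 'I_n}) :
  \sum_(z in A) nu z * (g z - \sum_w Q z w * g w) =
  \sum_(z in A) \sum_(w | w \notin A) nu z * Q z w * (g z - g w).
Proof.
pose F z w := nu z * Q z w * (g z - g w).
have rowE z : nu z * (g z - \sum_w Q z w * g w) = \sum_w F z w.
  rewrite -[X in X - _]mul1r -(Q_row1 z) mulr_suml -sumrB mulr_sumr.
  by apply: eq_bigr => w _; rewrite /F; ring.
have FN z w : F w z = - F z w by rewrite /F -Q_rev; ring.
have inner0 : \sum_(z in A) \sum_(w in A) F z w = 0.
  set s := LHS; have : s = - s.
    rewrite {1}/s exchange_big /= -sumrN; apply: eq_bigr => z _.
    by rewrite -sumrN; apply: eq_bigr => w _; rewrite FN.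
  by move=> ?; lra.
under eq_bigr => z _ do rewrite rowE (bigID (mem A)) /=.
by rewrite big_split /= inner0 add0r.
Qed.

(* The current through one edge is at most the total current out of the
   superlevel set {g >= g l}, since all terms of the latter are nonnegative. *)
Lemma edge_flow (g : 'I_n -> R) (b : R) (l m : 'I_n) : 0 <= b -> e l m ->
  (forall z, `|g z - \sum_w Q z w * g w| <= b) -> c * (g l - g m) <= b.
Proof.
move=> b0 elm hb; have [glm|gml] := leP (g l) (g m).
  by apply: le_trans b0; rewrite mulr_ge0_le0 ?subr_le0 // ltW.
pose A := [set z | g l <= g z]%SET.
have lA : l \in A by rewrite inE.
have mA : m \notin A by rewrite inE -ltNge.
have pos z w : z \in A -> w \notin A -> 0 <= nu z * Q z w * (g z - g w).
  rewrite !inE -ltNge => zA wA; have gwz := lt_le_trans wA zA.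
  rewrite mulr_ge0 ?subr_ge0 ?(ltW gwz) ?mulr_ge0 ?Q_ge0 //.
  by apply: contraTneq gwz => ->; rewrite ltxx.
apply: (@le_trans _ _ (nu l * Q l m * (g l - g m))).
  by rewrite ler_wpM2r ?subr_ge0 ?Q_edge // ltW.
apply: (@le_trans _ _
    (\sum_(z in A) \sum_(w | w \notin A) nu z * Q z w * (g z - g w))).
  rewrite (bigD1 l) //= (bigD1 m) //= -addrA lerDl addr_ge0 //.
    by apply: sumr_ge0 => w /andP[wA _]; exact: pos.
  apply: sumr_ge0 => z /andP[zA _].
  by apply: sumr_ge0 => w wA; exact: pos.
rewrite -superlevel_flow; apply: (@le_trans _ _ (\sum_z nu z * b)).
  rewrite big_mkcond /=; apply: ler_sum => z _; case: ifP => _.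
    by rewrite ler_wpM2l // (le_trans (ler_norm _)).
  by rewrite mulr_ge0.
by rewrite -mulr_suml nu_sum1 mul1r.
Qed.

(** By [edge_flow] each edge of a path costs at most b / c, and a path without repeated vertices has
    at most [n] edges. *)
Lemma oscillation_le (g : 'I_n -> R) (b : R) (x y : 'I_n) : 0 <= b ->
  (forall z, `|g z - \sum_w Q z w * g w| <= b) -> g x - g y <= n%:R * (b / c).
Proof.
move=> b0 hb; have bc0 : 0 <= b / c by rewrite divr_ge0 // ltW.
have /connectP[p0 ep0 ->] := e_conn x y.
have -> : last x p0 = last x (shorten x p0) by case: (shortenP ep0).
case: (shortenP ep0) => p ep up _.
have szp : (size p <= n)%N.
  rewrite -[X in (_ <= X)%N]card_ord ltnW //.
  by have := max_card (mem (x :: p)); rewrite (card_uniqP up).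
apply: (@le_trans _ _ ((size p)%:R * (b / c))); last first.
  by rewrite ler_wpM2r // ler_nat.
move: ep => {ep0 up szp p0 y}; elim: p x => [|z p IHp] x /=.
  by rewrite subrr mul0r.
case/andP=> exz /IHp{IHp}; have := edge_flow b0 exz hb.
rewrite mulrC -ler_pdivlMr // -[(size p).+1]addn1 natrD mulrDl mul1r => h1 h2.
have -> : g x - g (last z p) = (g z - g (last z p)) + (g x - g z) by ring.
exact: lerD.
Qed.

Lemma poisson_solution (h : 'I_n -> R) : (forall z, `|h z| <= 1) ->
    \sum_z nu z * h z = 0 ->
  exists g : 'I_n -> R, (forall z, g z - \sum_w Q z w * g w = h z) /\
    (forall z, `|g z| <= n%:R / c).
Proof.
move=> h1 nuh0.
(* The rank-one term forces \sum_w nu w * g w = 0 and makes B invertible. *)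
pose B : 'M[R]_n := 1%:M - Q + \matrix_(i, j) nu j.
have BE (g : 'cV[R]_n) z : (B *m g) z 0 =
    g z 0 - \sum_w Q z w * g w 0 + \sum_w nu w * g w 0.
  rewrite mxE -sumrN.
  have -> : g z 0 = \sum_w (z == w)%:R * g w 0.
    rewrite (bigD1 z) //= eqxx mul1r big1 ?addr0 // => w.
    by rewrite eq_sym => /negbTE ->; rewrite mul0r.
  rewrite -!big_split /=; apply: eq_bigr => w _.
  by rewrite !mxE; ring.
have nuB (g : 'cV[R]_n) : \sum_z nu z * (B *m g) z 0 = \sum_w nu w * g w 0.
  (* Nothing flows out of the full set, so [nu] is invariant under [Q] and annihilates the range of
     I - Q. *)
  have /eqP : \sum_(z in [set: 'I_n]%SET)
      nu z * (g z 0 - \sum_w Q z w * g w 0) = 0.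
    rewrite superlevel_flow; apply: big1 => z _; apply: big1 => w.
    by rewrite inE.
  rewrite (eq_bigl xpredT) => [|z]; last by rewrite inE.
  move=> /eqP inv0.
  under eq_bigr => z _ do rewrite BE mulrDr.
  by rewrite big_split /= inv0 add0r -mulr_suml nu_sum1 mul1r.
(* A function of mean zero is at each point an average of its differences, so its oscillation bounds
   it. *)
have osc0 (g : 'I_n -> R) (b : R) z : 0 <= b ->
    (forall z, `|g z - \sum_w Q z w * g w| <= b) ->
    \sum_w nu w * g w = 0 -> `|g z| <= n%:R * (b / c).
  move=> b0 hb nug0.
  have -> : g z = \sum_w nu w * (g z - g w).
    under eq_bigr do rewrite mulrBr.
    by rewrite sumrB nug0 subr0 -mulr_suml nu_sum1 mul1r.
  have -> : n%:R * (b / c) = \sum_w nu w * (n%:R * (b / c)).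
    by rewrite -mulr_suml nu_sum1 mul1r.
  apply: le_trans (ler_norm_sum _ _ _) _; apply: ler_sum => w _.
  rewrite normrM (ger0_norm (nu_ge0 w)) ler_wpM2l // ler_norml.
  by rewrite lerNl opprB; apply/andP; split; exact: oscillation_le.
(* A kernel vector of [B] has mean zero by [nuB], hence is harmonic, and [osc0] with b = 0 makes it
   vanish. *)
have uB : B \in unitmx.
  rewrite -unitmx_tr -row_free_unit -kermx_eq0; apply/eqP/row_matrixP => i.
  rewrite row0; set v := row i _.
  have Bv : B *m v^T = 0.
    apply: trmx_inj; rewrite trmx_mul trmxK trmx0.
    by apply/sub_kermxP; rewrite row_sub.
  have nuv : \sum_w nu w * v^T w 0 = 0.
    by rewrite -nuB Bv big1 // => z _; rewrite mxE mulr0.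
  have hv z : `|v^T z 0 - \sum_w Q z w * v^T w 0| <= 0.
    by have := BE v^T z; rewrite nuv addr0 => <-; rewrite Bv mxE normr0.
  apply/rowP => z; have := osc0 (fun z => v^T z 0) 0 z (lexx _) hv nuv.
  by rewrite mul0r mulr0 normr_le0 !mxE => /eqP.
pose g := invmx B *m \col_z h z.
have Bg : B *m g = \col_z h z by rewrite mulmxA mulmxV // mul1mx.
(* The mean of [g] equals that of [h], so the rank-one term disappears from the equation for [g]. *)
have nug : \sum_w nu w * g w 0 = 0.
  by rewrite -nuB Bg -[RHS]nuh0; apply: eq_bigr => z _; rewrite mxE.
have gE z : g z 0 - \sum_w Q z w * g w 0 = h z.
  by have := BE g z; rewrite nug addr0 Bg mxE.
exists (fun z => g z 0); split => // z.
have := osc0 (fun z => g z 0) 1 z ler01 _ nug.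
by rewrite div1r; apply => w; rewrite gE.
Qed.

End Poisson.

(** * Conductance bounds for the target matrices *)

Lemma connected_neighbour (S : finType) (E : rel S) (x y : S) :
  connect E x y -> x != y -> exists z, E x z.
Proof.
move=> /connectP[[|z p] /= ep ->]; first by rewrite eqxx.
by case/andP: ep => exz _ _; exists z.
Qed.

Section TargetMatrix.
Variables (R : realType) (S : finType) (E : rel S).
Variables (lab : 'I_#|S| -> S) (nu : S -> R) (b : R).
Hypothesis E_graph : simple_graph E.
Hypothesis E_conn : connected_graph E.
Hypothesis lab_bij : bijective lab.
Hypothesis S_gt1 : (1 < #|S|)%N.
Hypothesis nu_sum1 : \sum_s nu s = 1.
Hypothesis b_gt0 : 0 < b.
Hypothesis nu_lb : forall s, b <= nu s.

Let N := #|S|.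
Let nu_gt0 s : 0 < nu s. Proof. exact: lt_le_trans (nu_lb s). Qed.
Let lab_inj : injective lab. Proof. exact: bij_inj. Qed.
Let Q := target_matrix E lab nu.

Lemma sum_lab (f : S -> R) : \sum_l f (lab l) = \sum_s f s.
Proof.
case: lab_bij => lab' labK lab'K.
by rewrite [RHS](reindex lab) //; exists lab' => x _.
Qed.

Lemma lab_connect x y : connect [rel l m | E (lab l) (lab m)] x y.
Proof.
case: lab_bij => lab' labK lab'K.
have /connectP[p] := E_conn.2 (lab x) (lab y).
elim: p x => [|z p IHp] x /=; first by move=> _ /lab_inj ->.
case/andP => exz ep yE; apply: (@connect_trans _ _ (lab' z)).
  by apply: connect1; rewrite /= lab'K.
by apply: IHp; rewrite lab'K.
Qed.

(** Inversion sends 0 to 0, so a state of weight 0 would bring [edge_prob] down to 0. Connectivity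
    and N > 1 supply a neighbour, hence a positive term in one of the two sums. *)
Lemma weight_gt0 l : 0 < weight E lab nu l.
Proof.
have [m nlm] : exists m : 'I_N, l != m.
  have [i [j [_ _ nij]]] : exists i j, [/\ i \in 'I_N, j \in 'I_N & i != j].
    by apply/card_gt1P; rewrite card_ord.
  by have [->|] := eqVneq l i; [exists j|exists i].
have [z /= elz] := connected_neighbour (lab_connect l m) nlm.
have w_ge0 (A : pred 'I_N) : 0 <= \sum_(m | A m) nu (lab m) / nu (lab l).
  by apply: sumr_ge0 => i _; rewrite divr_ge0 // ltW.
have o_ge0 (A : pred 'I_N) : 0 <= \sum_(m : 'I_N | A m) (1 : R).
  by apply: sumr_ge0.
rewrite /weight; have [llz|zll|lz] := ltngtP l z.
- apply: ltr_wpDr; first exact: w_ge0.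
  by rewrite (bigD1 z) ?llz //=; apply: ltr_wpDr.
- apply: ltr_wpDl; first exact: o_ge0.
  by rewrite (bigD1 z) ?zll //=; apply: ltr_wpDr; rewrite ?w_ge0 ?divr_gt0.
- by move: elz; rewrite (val_inj lz) E_graph.2.
Qed.

(** In the second sum the numerators add up to at most 1 and the common denominator is at least
    [b]. *)
Lemma weight_le l : weight E lab nu l <= N%:R + b^-1.
Proof.
apply: lerD.
  apply: (@le_trans _ _ (\sum_(m : 'I_N) (1 : R))).
    by rewrite [leLHS]big_mkcond /=; apply: ler_sum => i _; case: ifP.
  by rewrite sumr_const card_ord.
apply: (@le_trans _ _ (\sum_m nu (lab m) / nu (lab l))).
  rewrite [leLHS]big_mkcond /=; apply: ler_sum => i _; case: ifP => // _.
  by rewrite divr_ge0 // ltW.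
by rewrite -mulr_suml sum_lab nu_sum1 mul1r lef_pV2 ?posrE.
Qed.

Lemma edge_prob_ge : 1 / (2 * (N%:R + b^-1)) <= edge_prob E lab nu.
Proof.
have S_gt0 := ltnW S_gt1.
rewrite /edge_prob; set m := (\big[_/_]_(l < _) _)%E.
have lem : ((1 / (2 * (N%:R + b^-1)))%:E <= m)%E.
  apply/bigmin_geP; split=> [|l _]; first exact: leey.
  rewrite lee_fin !div1r lef_pV2 ?posrE ?mulr_gt0 ?weight_gt0 //.
    by rewrite ler_pM2l // weight_le.
  by rewrite addr_gt0 ?invr_gt0 ?ltr0n.
(* Comparison with one term of the minimum excludes +oo, on which [fine] would return 0. *)
have mle : (m <= (1 / (2 * weight E lab nu (Ordinal S_gt0)))%:E)%E.
  exact: bigmin_le_cond.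
by case: m lem mle => [r| |]; rewrite ?lee_fin.
Qed.

Let p := edge_prob E lab nu.
Let p_gt0 : 0 < p.
Proof.
apply: lt_le_trans edge_prob_ge.
by rewrite divr_gt0 // mulr_gt0 // addr_gt0 ?invr_gt0 ?ltr0n ?(ltnW S_gt1).
Qed.

Lemma target_row_sum l : \sum_m Q l m = 1.
Proof.
rewrite (bigD1 l) //= {1}/Q mxE eqxx -/p.
suff -> : \sum_(m | m != l) Q l m = p * weight E lab nu l by rewrite subrK.
rewrite (bigID (fun m : 'I_N => (l < m)%N)) /= /weight mulrDr !mulr_sumr.
congr (_ + _); rewrite [LHS]big_mkcond [RHS]big_mkcond /=;
  apply: eq_bigr => m _; rewrite mxE -/p [m == l]eq_sym -!val_eqE /=;
  by case: (ltngtP l m) => //= _; case: ifP => // _; rewrite ?mulr1 // mulrC.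
Qed.

(** On an edge both sides are [edge_prob] times the mass of the endpoint with the smaller label;
    this is the conductance of the edge. *)
Lemma target_reversible l m : nu (lab l) * Q l m = nu (lab m) * Q m l.
Proof.
rewrite !mxE -/p [m == l]eq_sym E_graph.1; case: eqVneq => [->//|nlm].
case: ifP => _; last by rewrite !mulr0.
have := lt0r_neq0 (nu_gt0 (lab l)); have := lt0r_neq0 (nu_gt0 (lab m)).
case: ltngtP => [_|_|/val_inj lm] hl hm; [by field|by field|].
by rewrite lm eqxx in nlm.
Qed.

Lemma target_offdiag_ge0 l m : l != m -> 0 <= Q l m.
Proof.
move=> /negbTE nlm; rewrite mxE nlm -/p; case: ifP => // _.
case: ifP => _; first exact: ltW.
by apply: mulr_ge0; [apply: divr_ge0|]; exact: ltW.
Qed.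

(** The conductance is [edge_prob] times a mass, and masses are at least [b]. For b = 1 / (kN) the
    bound is of order 1 / k^2. *)
Lemma target_edge_ge l m : E (lab l) (lab m) ->
  b * (1 / (2 * (N%:R + b^-1))) <= nu (lab l) * Q l m.
Proof.
move=> elm; apply: (@le_trans _ _ (b * p)).
  by rewrite ler_pM2l // edge_prob_ge.
rewrite mxE elm -/p; case: eqVneq => [lm|_].
  by rewrite lm E_graph.2 in elm.
case: ifP => _; first by rewrite ler_pM2r.
rewrite mulrA mulrCA divff ?lt0r_neq0 // mulr1.
by rewrite ler_pM2r.
Qed.

(** The right-hand side has mean zero under [nu] and absolute value at most 1, as [poisson_solution]
    requires; the bound is N over the conductance bound of [target_edge_ge]. *)
Lemma target_poisson (s : S) : exists g : 'I_N -> R,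
  (forall l, g l - \sum_m Q l m * g m = (lab l == s)%:R - nu s) /\
  (forall l, `|g l| <= N%:R / (b * (1 / (2 * (N%:R + b^-1))))).
Proof.
have nu_le1 : nu s <= 1.
  rewrite -nu_sum1 (bigD1 s) //= lerDl; apply: sumr_ge0 => i _; exact: ltW.
apply: (@poisson_solution R N [rel l m | E (lab l) (lab m)] (nu \o lab)) => /=.
- exact: lab_connect.
- by move=> l; exact: ltW.
- by rewrite sum_lab.
- exact: target_row_sum.
- exact: target_reversible.
- exact: target_offdiag_ge0.
- by rewrite mulr_gt0 // divr_gt0 // mulr_gt0 // addr_gt0 ?invr_gt0 ?ltr0n
    ?(ltnW S_gt1).
- exact: target_edge_ge.
- move=> l; have := ltW (nu_gt0 s); case: eqP => _ /= nu0;
    rewrite ler_norml; apply/andP; split; lra.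
- rewrite (sum_lab (fun t => nu t * ((t == s)%:R - nu s))).
  under eq_bigr do rewrite mulrBr.
  rewrite sumrB -mulr_suml nu_sum1 mul1r (bigD1 s) //= eqxx mulr1 big1 ?addr0.
    by rewrite subrr.
  by move=> i /negbTE ->; rewrite mulr0.
Qed.

End TargetMatrix.

(** * The perturbed distributions *)

Section PerturbedDistribution.
Variables (R : realType) (S : finType) (E : rel S) (mu : S -> R).
Hypothesis E_graph : simple_graph E.
Hypothesis E_conn : connected_graph E.
Hypothesis mu_dist : distribution_on mu.
Hypothesis supp_disc : ~ connected_graph (induced_subgraph E (supp mu)).

Let N := #|S|.

(** If all masses were positive, the induced subgraph would be the whole graph, which is
    connected. *)
Lemma exists_null : exists s, mu s = 0.
Proof.
apply: contrapT => /forallNP mu_neq0.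
have mu_gt0 s : s \in supp mu.
  by rewrite inE lt_def mu_dist.1 andbT; apply/eqP/mu_neq0.
apply: supp_disc; split.
  by have [/card_gt0P[x _] _] := E_conn; apply/card_gt0P;
    exists (Sub x (mu_gt0 x)).
move=> x y; have /connectP[p] := E_conn.2 (val x) (val y).
elim: p x => [|z p IHp] x /=.
  by move=> _ /val_inj ->.
case/andP => exz ep yE; apply: (@connect_trans _ _ (Sub z (mu_gt0 z))).
  exact: connect1.
exact: IHp.
Qed.

(** A state of mass 1 would be the whole support, and a single vertex is connected. This serves the
    case k = 1, where every state has to lie in [low_mass]. *)
Lemma mu_lt1 s : mu s < 1.
Proof.
rewrite ltNge; apply/negP => mus1; apply: supp_disc.
have uniq_supp t : t \in supp mu -> t = s.
  rewrite inE => mut0; apply/eqP; apply: contraTT mut0 => nts.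
  rewrite -leNgt; have := mu_dist.2; rewrite (bigD1 s) //= (bigD1 t) //=.
  set r := \sum_(_ | _) _; have : 0 <= r.
    by apply: sumr_ge0 => i _; exact: mu_dist.1.
  by move=> r0 sum1; lra.
have sS : s \in supp mu by rewrite inE (lt_le_trans ltr01).
split; first by apply/card_gt0P; exists (Sub s sS).
move=> x y; suff -> : x = y by exact: connect0.
by apply: val_inj; rewrite (uniq_supp _ (valP x)) (uniq_supp _ (valP y)).
Qed.

Lemma card_gt1_of_disconnected : (1 < N)%N.
Proof.
have [s0 s00] := exists_null.
have : exists s, s != s0.
  apply: contrapT => /forallNP none; have := mu_dist.2.
  rewrite (bigD1 s0) //= s00 big1 ?addr0 => [|i]; last by move/none.
  by move/eqP; rewrite eq_sym oner_eq0.
by move=> [s ns]; apply/card_gt1P; exists s, s0.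
Qed.

Lemma low_mass_gt0 k : (0 < k)%N -> (0 < #|low_mass mu k|)%N.
Proof.
move=> k0; have [s s0] := exists_null; apply/card_gt0P; exists s.
by rewrite inE s0 divr_gt0 // ltr0n.
Qed.

Lemma perturbed_sum1 k : (0 < k)%N -> \sum_s mu_ mu k s = 1.
Proof.
move=> k0; have kn0 : k%:R != 0 :> R by rewrite pnatr_eq0 -lt0n.
have An0 : #|low_mass mu k|%:R != 0 :> R.
  by rewrite pnatr_eq0 -lt0n low_mass_gt0.
rewrite /mu_ big_split /= -!mulr_sumr mu_dist.2.
have -> : \sum_s uniform_on R (low_mass mu k) s = 1.
  rewrite /uniform_on -big_mkcond /= sumr_const -[LHS]mulr_natl.
  by rewrite div1r divff.
by field.
Qed.

(** A low-mass state gets at least 1 / (kN) from the uniform part. Any other state has mass at least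
    1 / k and forces k >= 2, so the factor (k - 1) / k >= 1 / 2 >= 1 / N suffices. *)
Lemma perturbed_ge k s : (0 < k)%N -> (k%:R * N%:R)^-1 <= mu_ mu k s.
Proof.
move=> k0; have kr0 : (0 : R) < k%:R by rewrite ltr0n.
have N2 : (2 : R) <= N%:R by rewrite (ler_nat _ 2) card_gt1_of_disconnected.
have mu0 := mu_dist.1 s.
have k1 : (1 : R) <= k%:R by rewrite (ler_nat _ 1).
have AN : (#|low_mass mu k|%:R : R) <= N%:R by rewrite ler_nat max_card.
have A0 : (0 : R) < #|low_mass mu k|%:R by rewrite ltr0n low_mass_gt0.
rewrite /mu_ /uniform_on invfM inE; case: ifP => [_|/negbT].
  rewrite !div1r -[leLHS]addr0; apply: lerD.
    by rewrite ler_pM2l ?invr_gt0 // lef_pV2 ?posrE //; lra.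
  by rewrite mulr_ge0 // divr_ge0 // subr_ge0.
rewrite -leNgt div1r mulr0 add0r => muk.
have k2 : (2 : R) <= k%:R.
  rewrite (ler_nat _ 2) ltnNge; apply/negP => k1'.
  have kE : k = 1%N by apply/eqP; rewrite eqn_leq k1' k0.
  by move: muk; rewrite kE invr1 leNgt mu_lt1.
rewrite mulrC; apply: ler_pM => //.
rewrite ler_pdivlMr // mulrC ler_pdivrMr; last lra.
(* What remains is k <= (k - 1) N, whose slack is this product plus k + N - 4. *)
have : 0 <= (k%:R - 2) * (N%:R - 2) :> R by rewrite mulr_ge0 // subr_ge0.
by nra.
Qed.

Lemma perturbed_close k s : (0 < k)%N -> `|mu_ mu k s - mu s| <= k%:R^-1.
Proof.
move=> k0; have kn0 : k%:R != 0 :> R by rewrite pnatr_eq0 -lt0n.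
have -> : mu_ mu k s - mu s =
    k%:R^-1 * (uniform_on R (low_mass mu k) s - mu s) by rewrite /mu_; field.
rewrite normrM ger0_norm ?invr_ge0 // ler_piMr ?invr_ge0 //.
have mu0 := mu_dist.1 s; have mu1 := mu_lt1 s.
have : 0 <= uniform_on R (low_mass mu k) s <= 1.
  rewrite /uniform_on; case: ifP => _; last by rewrite lexx ler01.
  by rewrite div1r invr_ge0 ler0n invf_le1 ?ltr0n ?(ler_nat _ 1) low_mass_gt0.
by case/andP => u0 u1; rewrite ler_norml; apply/andP; split; lra.
Qed.

Lemma perturbed_poisson (lab : 'I_#|S| -> S) k s : bijective lab -> (0 < k)%N ->
  exists g : 'I_N -> R,
  (forall l, g l - \sum_m target_matrix E lab (mu_ mu k) l m * g m =
     (lab l == s)%:R - mu_ mu k s) /\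
  (forall l, `|g l| <= 4 * N%:R ^+ 3 * k%:R ^+ 2).
Proof.
move=> lab_bij k0.
have k1 : (1 : R) <= k%:R by rewrite (ler_nat _ 1).
have N2 : (2 : R) <= N%:R by rewrite (ler_nat _ 2) card_gt1_of_disconnected.
have b0 : 0 < (k%:R * N%:R : R)^-1 by rewrite invr_gt0 mulr_gt0 //; lra.
have [g [gE gle]] := target_poisson E_graph E_conn lab_bij
  card_gt1_of_disconnected (perturbed_sum1 k0) b0
  (fun s => perturbed_ge s k0) s.
exists g; split=> // l; apply: le_trans (gle l) _.
rewrite invrK div1r -invfM invrK -/N.
have kN : N%:R <= k%:R * N%:R :> R by rewrite ler_peMl //; lra.
(* For b = 1 / (kN) the bound of [target_poisson] is N * kN * 2 (N + kN); replacing the summand N by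
   kN gives the constant 4. *)
have -> : 4 * N%:R ^+ 3 * k%:R ^+ 2 =
  N%:R * (k%:R * N%:R * (2 * (k%:R * N%:R + k%:R * N%:R))) :> R by ring.
rewrite ler_pM2l; last lra.
rewrite ler_pM2l; last by rewrite mulr_gt0 //; lra.
by rewrite ler_pM2l ?ltr0n // lerD2r.
Qed.

End PerturbedDistribution.

(** * Finite-valued random variables and Chebyshev's inequality *)

Section FiniteValued.
Variables (R : realType) (d : measure_display) (Omega : measurableType d).
Variable P : probability Omega R.

(** Expectations of functions of [Z] become finite sums weighted by [law Z], without integrals. *)
Definition law (T : finType) (Z : Omega -> T) (x : T) : R :=
  fine (P (Z @^-1` [set x])).

Definition fin_measurable (T : finType) (Z : Omega -> T) : Prop :=
  forall x, measurable (Z @^-1` [set x]).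

Lemma prob_preimage (T : finType) (Z : Omega -> T) (A : pred T) :
    fin_measurable Z ->
  measurable (Z @^-1` [set x | A x]) /\
  P (Z @^-1` [set x | A x]) = (\sum_(x | A x) law Z x)%:E.
Proof.
move=> mZ.
have -> : Z @^-1` [set x | A x] =
    \bigcup_(x in [set x | A x]) (Z @^-1` [set x]).
  by apply/seteqP; split=> w /=; [exists (Z w)|case=> x /= ? ->].
split; first exact: fin_bigcup_measurable.
rewrite measure_fin_bigcup //=; last by move=> x y _ _ [w [/= <- <-]].
rewrite -sumEFin (fsbigE (enum A)) ?enum_uniq //.
- rewrite big_enum_cond; apply: eq_big => [x|x _].
    by rewrite mem_setE andb_idr.
  by rewrite fineK ?fin_num_measure.
- by move=> x /=; rewrite mem_enum.
- by move=> x /= Ax; rewrite mem_enum /in_mem /= Ax.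
Qed.

Lemma law_ge0 (T : finType) (Z : Omega -> T) x : 0 <= law Z x.
Proof. by rewrite fine_ge0. Qed.

Lemma law_sum1 (T : finType) (Z : Omega -> T) :
  fin_measurable Z -> \sum_x law Z x = 1.
Proof.
move=> mZ; have [_] := prob_preimage xpredT mZ.
have -> : Z @^-1` [set x | xpredT x] = setT by apply/seteqP.
by rewrite probability_setT => -[].
Qed.

Lemma law_comp (T T' : finType) (Z : Omega -> T) (U : T -> T') (u : T') :
  fin_measurable Z -> law (U \o Z) u = \sum_(x | U x == u) law Z x.
Proof.
move=> mZ; have [_ +] := prob_preimage [pred x | U x == u] mZ.
move=> /(congr1 fine) /= <-; rewrite /law; congr (fine (P _)).
by apply/seteqP; split=> w /= /eqP.
Qed.

Lemma expectation_comp (T T' : finType) (Z : Omega -> T) (U : T -> T')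
    (f : T' -> R) : fin_measurable Z ->
  \sum_x f (U x) * law Z x = \sum_u f u * law (U \o Z) u.
Proof.
move=> mZ; rewrite (partition_big U xpredT) //=; apply: eq_bigr => u _.
by rewrite law_comp // mulr_sumr; apply: eq_bigr => x /eqP ->.
Qed.

Lemma fin_chebyshev (T : finType) (Z : Omega -> T) (f : T -> R) (a b : R) :
    fin_measurable Z -> 0 < a -> \sum_x f x ^+ 2 * law Z x <= b ->
  measurable [set w | a <= `|f (Z w)|] /\
  (P [set w | (a <= `|f (Z w)|)%R] <= (b / a ^+ 2)%:E)%E.
Proof.
move=> mZ a0 fb; have [mA PA] := prob_preimage [pred x | a <= `|f x|] mZ.
split=> //; rewrite [X in (P X <= _)%E](_ : _ =
  Z @^-1` [set x | [pred x | a <= `|f x|] x]) // PA lee_fin.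
rewrite ler_pdivlMr ?exprn_gt0 // (le_trans _ fb) //.
rewrite mulr_suml [leLHS]big_mkcond /=; apply: ler_sum => x _.
case: ifP => [afx|_]; last by rewrite mulr_ge0 ?sqr_ge0 ?law_ge0.
rewrite mulrC ler_wpM2r ?law_ge0 // -[leRHS]real_normK ?num_real //.
by rewrite lerXn2r ?nnegrE // ltW.
Qed.

End FiniteValued.

(** * Martingales along a Markov chain *)

Section MarkovMartingale.
Variables (R : realType) (d : measure_display) (Omega : measurableType d).
Variables (P : probability Omega R) (n : nat).
Variables (Y : nat -> Omega -> 'I_n) (Q : nat -> 'M[R]_n).

Definition history (t : nat) (w : Omega) : {ffun 'I_t.+1 -> 'I_n} :=
  [ffun i : 'I_t.+1 => Y i w].

Hypothesis Y_meas : forall t l, measurable [set w | Y t w = l].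
Hypothesis Y_markov : forall t (x : {ffun 'I_t.+1 -> 'I_n}) (m : 'I_n),
  law P (fun w => (history t w, Y t.+1 w)) (x, m) =
  law P (history t) x * Q t (x ord_max) m.

Lemma history_measurable t : fin_measurable (history t).
Proof.
move=> x; have -> : history t @^-1` [set x] =
    \bigcap_(i in [set: 'I_t.+1]) [set w | Y i w = x i].
  apply/seteqP; split=> w /=.
    by move=> <- i _ /=; rewrite ffunE.
  by move=> wx; apply/ffunP => i; rewrite ffunE; exact: wx.
by apply: fin_bigcap_measurable => // i _; exact: Y_meas.
Qed.

(** The path is an argument, so that the sum applies to a trajectory [Y ^~ w] and, through [inord],
    to a finite history. *)
Definition increments (D : nat -> 'I_n -> 'I_n -> R) (t : nat)
    (y : nat -> 'I_n) : R := \sum_(0 <= i < t) D i (y i) (y i.+1).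

Variables (D : nat -> 'I_n -> 'I_n -> R).
Hypothesis D_centred : forall t l, \sum_m Q t l m * D t l m = 0.

(** Martingale differences are orthogonal, so second moments add up, each at most b^2. The horizon
    [T] stays fixed during the induction on t, so that all expectations use the law of one
    history. *)
Lemma second_moment_le (T : nat) (b : R) :
    (forall t l m, (t < T)%N -> `|D t l m| <= b) ->
  \sum_(x : {ffun 'I_T.+1 -> 'I_n})
    increments D T (fun i => x (inord i)) ^+ 2 * law P (history T) x <=
  T%:R * b ^+ 2.
Proof.
move=> D_le; pose M t (x : {ffun 'I_T.+1 -> 'I_n}) :=
  increments D t (fun i => x (inord i)).
suff H t : (t <= T)%N ->
    \sum_x M t x ^+ 2 * law P (history T) x <= t%:R * b ^+ 2 by exact: H.
elim: t => [_|t IHt tT].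
  rewrite mul0r big1 // => x _.
  by rewrite /M /increments big_nil expr0n mul0r.
pose Dt (x : {ffun 'I_T.+1 -> 'I_n}) := D t (x (inord t)) (x (inord t.+1)).
have MS x : M t.+1 x = M t x + Dt x by rewrite /M /increments big_nat_recr.
(* The cross term depends only on the history up to t and the next state. Their joint law factors by
   [Y_markov], and the sum over the next state vanishes by [D_centred]. *)
have cross0 : \sum_x M t x * Dt x * law P (history T) x = 0.
  pose U (x : {ffun 'I_T.+1 -> 'I_n}) : {ffun 'I_t.+1 -> 'I_n} * 'I_n :=
    ([ffun i : 'I_t.+1 => x (inord i)], x (inord t.+1)).
  pose f (z : {ffun 'I_t.+1 -> 'I_n} * 'I_n) :=
    increments D t (fun i => z.1 (inord i)) * D t (z.1 ord_max) z.2.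
  have fU x : M t x * Dt x = f (U x).
    rewrite /f /U /= ffunE /=; congr (_ * _).
    apply: eq_big_nat => i /andP[_ it].
    by rewrite !ffunE !inordK // ltnW.
  under eq_bigr do rewrite fU.
  rewrite (expectation_comp P U f (@history_measurable T)).
  have -> : U \o history T = fun w => (history t w, Y t.+1 w).
    apply/funext => w; rewrite /U /history /= ffunE inordK //; congr (_, _).
    apply/ffunP => i.
    by rewrite !ffunE inordK // (leq_trans (ltn_ord i)) // ltnW.
  transitivity (\sum_(x : {ffun 'I_t.+1 -> 'I_n}) \sum_m
      f (x, m) * law P (fun w => (history t w, Y t.+1 w)) (x, m)).
    by rewrite pair_bigA; apply: eq_bigr => -[].
  apply: big1 => x _; under eq_bigr do rewrite Y_markov /f /=.
  set a := increments _ _ _; set c := law _ _ _.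
  transitivity (a * c * \sum_m Q t (x ord_max) m * D t (x ord_max) m).
    by rewrite mulr_sumr; apply: eq_bigr => m _; ring.
  by rewrite D_centred mulr0.
have -> : \sum_x M t.+1 x ^+ 2 * law P (history T) x =
    \sum_x M t x ^+ 2 * law P (history T) x +
    2 * (\sum_x M t x * Dt x * law P (history T) x) +
    \sum_x Dt x ^+ 2 * law P (history T) x.
  rewrite mulr_sumr -!big_split /=; apply: eq_bigr => x _.
  by rewrite MS; ring.
rewrite cross0 mulr0 addr0 -[t.+1]addn1 natrD mulrDl mul1r.
apply: lerD; first by apply: IHt; exact: ltnW.
rewrite -[leRHS]mulr1 -(law_sum1 P (@history_measurable T)) mulr_sumr.
apply: ler_sum => x _; apply: ler_wpM2r; first exact: law_ge0.
rewrite -[leLHS]real_normK ?num_real // lerXn2r ?nnegrE ?D_le //.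
(* The side condition 0 <= b follows from any instance of [D_le]; [x ord0] is a state at hand. *)
by apply: le_trans (D_le t (x ord0) (x ord0) tT).
Qed.

Lemma martingale_tail_le (T : nat) (a b : R) : 0 < a ->
    (forall t l m, (t < T)%N -> `|D t l m| <= b) ->
  measurable [set w | a <= `|increments D T (Y ^~ w)|] /\
  (P [set w | (a <= `|increments D T (Y ^~ w)|)%R] <=
    (T%:R * b ^+ 2 / a ^+ 2)%:E)%E.
Proof.
move=> a0 D_le; have := fin_chebyshev (@history_measurable T) a0
  (second_moment_le D_le).
suff E w : increments D T (fun i => history T w (inord i)) =
    increments D T (Y ^~ w) by under eq_fun do rewrite E.
by apply: eq_big_nat => i /andP[_ iT]; rewrite !ffunE !inordK // ltnW.
Qed.

(** At time k^4 the second moment is at most C^2 k^6, so a deviation of k^4 / j has probability at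
    most C^2 j^2 / k^2, which is summable in k. *)
Lemma martingale_subsequence_cvg (C : R) :
    (forall k t l m, (t < k ^ 4)%N -> `|D t l m| <= C * k%:R) ->
  {ae P, forall w, (fun k => (k ^ 4)%:R^-1 * increments D (k ^ 4) (Y ^~ w)) @
    \oo --> (0 : R)}.
Proof.
move=> D_le.
pose F (j k : nat) := [set w | (k.+1 ^ 4)%:R / j.+1%:R <=
  `|increments D (k.+1 ^ 4) (Y ^~ w)|].
have FP j k : measurable (F j k) /\
    (P (F j k) <= (C ^+ 2 * j.+1%:R ^+ 2 * k.+1%:R ^- 2)%:E)%E.
  have a0 : 0 < (k.+1 ^ 4)%:R / j.+1%:R :> R.
    by rewrite divr_gt0 ?ltr0n // expn_gt0.
  have [mF PF] := martingale_tail_le a0 (D_le k.+1).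
  split=> //; apply: (le_trans PF); rewrite lee_fin natrX le_eqVlt.
  apply/orP; left; apply/eqP.
  have : k.+1%:R != 0 :> R by rewrite pnatr_eq0.
  have : j.+1%:R != 0 :> R by rewrite pnatr_eq0.
  by move: (k.+1%:R) (j.+1%:R) => x y y0 x0; field; rewrite x0 y0.
(* The bound telescopes: 1 / x^2 <= 2 / x - 2 / (x + 1) for x >= 1. *)
have inv_sq m : \sum_(0 <= k < m) k.+1%:R ^- 2 <= 2 - 2 / m.+1%:R :> R.
  elim: m => [|m IHm]; first by rewrite big_nil divr1 subrr.
  rewrite big_nat_recr //=; apply: le_trans (lerD IHm (lexx _)) _.
  have : (1 : R) <= m.+1%:R by rewrite (ler_nat _ 1).
  rewrite -[m.+2]addn1 natrD; move: (m.+1%:R) => x x1; rewrite -subr_ge0.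
  have -> : 2 - 2 / (x + 1) - (2 - 2 / x + x ^- 2) =
      (x - 1) / (x ^+ 2 * (x + 1)).
    by field; apply/andP; split; apply: lt0r_neq0; lra.
  by rewrite divr_ge0 ?subr_ge0 // mulr_ge0 ?sqr_ge0 //; lra.
(* Borel-Cantelli: the exceptional set lies in the limit superior of the events [F j k], a null
   set. *)
have ev j : {ae P, forall w, exists m, forall k, (m <= k)%N -> ~ F j k w}.
  exists (lim_sup_set (F j)); split.
  - apply: bigcapT_measurable => m; apply: bigcup_measurable => k _.
    exact: (FP j k).1.
  - apply: lim_sup_set_cvg0 => [k|]; first exact: (FP j k).1.
    apply: (@le_lt_trans _ _ (C ^+ 2 * j.+1%:R ^+ 2 * 2)%:E); last exact: ltry.
    apply: lime_le; first exact: is_cvg_nneseries.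
    near=> m; apply: (@le_trans _ _
      (\sum_(0 <= k < m) (C ^+ 2 * j.+1%:R ^+ 2 * k.+1%:R ^- 2)%:E)%E).
      by apply: lee_sum => k _; exact: (FP j k).2.
    rewrite sumEFin lee_fin -mulr_sumr ler_wpM2l //.
      by apply: mulr_ge0; exact: sqr_ge0.
    by apply: le_trans (inv_sq m) _; rewrite gerDl oppr_le0 divr_ge0.
  - move=> w /= /forallNP nev m _; have /existsNP[k] := nev m.
    by move=> /not_implyP[mk /contrapT Fk]; exists k.
have := ae_foralln ev; apply: filterS => w evw.
apply/cvgrPdist_lt => eps eps0.
(* This j satisfies 1 / (j + 1) <= eps. Since [F j k] concerns time (k + 1)^4, it is used below at
   [k.-1]. *)
have [m mP] := evw (Num.truncn eps^-1).
near=> k; rewrite sub0r normrN.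
have k0 : (0 < k)%N by near: k; exact: nbhs_infty_gt.
have mk : (m <= k.-1)%N.
  by rewrite -ltnS prednK //; near: k; exact: nbhs_infty_gt.
have kr0 : (0 : R) < (k ^ 4)%:R by rewrite ltr0n expn_gt0 k0.
have := mP _ mk; rewrite /F /= prednK // => /negP; rewrite -ltNge => inc_lt.
rewrite normrM normfV normr_nat mulrC ltr_pdivrMr // (lt_le_trans inc_lt) //.
rewrite mulrC ler_wpM2r ?(ltW kr0) // invf_ple ?posrE ?ltr0n //.
by rewrite ltW // truncnS_gt.
Unshelve. all: by end_near. Qed.

End MarkovMartingale.

(** * Integer roots, epochs and deterministic limits *)

Lemma natural_root (e : nat) : (0 < e)%N ->
  exists K : nat -> nat, forall t,
    [/\ (0 < K t)%N, (K t ^ e <= maxn 1 t)%N & (t < (K t).+1 ^ e)%N].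
Proof.
move=> e0; suff /choice[K KP] : forall t, exists k,
    [/\ (0 < k)%N, (k ^ e <= maxn 1 t)%N & (t < k.+1 ^ e)%N] by exists K.
move=> t.
(* The maximum with 1 makes the root of 0 equal to 1, in accordance with the matrix prescribed at
   time 0. *)
have ex : exists k, (k ^ e <= maxn 1 t)%N by exists 1%N; rewrite exp1n leq_maxl.
have ub k : (k ^ e <= maxn 1 t)%N -> (k <= maxn 1 t)%N.
  apply: leq_trans; case: k => // k.
  by rewrite -[X in (X <= _)%N]expn1 leq_pexp2l.
case: (ex_maxnP ex ub) => k kP kmax; exists k; split=> //.
  by apply: kmax; rewrite exp1n leq_maxl.
rewrite ltnNge; apply/negP => kt; have /kmax := leq_trans kt (leq_maxr 1 t).
by rewrite ltnn.
Qed.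

Section NaturalRoot.
Variables (e : nat) (K : nat -> nat).
Hypothesis e_gt0 : (0 < e)%N.
Hypothesis KP : forall t,
  [/\ (0 < K t)%N, (K t ^ e <= maxn 1 t)%N & (t < (K t).+1 ^ e)%N].

Lemma natural_root_le (t k : nat) : (k ^ e <= maxn 1 t)%N -> (k <= K t)%N.
Proof.
have [K0 _ tlt] := KP t => kt; rewrite -ltnS -(ltn_exp2r _ _ e_gt0).
apply: leq_ltn_trans kt _; rewrite gtn_max tlt andbT.
by rewrite -(exp1n e) ltn_exp2r.
Qed.

Lemma natural_root_homo : {homo K : s t / (s <= t)%N}.
Proof.
move=> s t st; have [_ Ks _] := KP s; apply: natural_root_le.
by apply: leq_trans Ks _; rewrite geq_max leq_maxl /= leq_max st orbT.
Qed.

Lemma natural_root_cvg (R : realType) :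
  (fun t => (K t)%:R^-1 : R) @ \oo --> (0 : R).
Proof.
apply/cvgrPdist_lt => eps eps0; near=> t; rewrite sub0r normrN.
have [K0 _ _] := KP t.
rewrite ger0_norm ?invr_ge0 // invf_plt ?posrE ?ltr0n //.
have lo : (Num.truncn eps^-1).+1%:R <= (K t)%:R :> R.
  rewrite ler_nat; apply: natural_root_le; rewrite leq_max; apply/orP; right.
  by near: t; exact: nbhs_infty_ge.
by apply: lt_le_trans lo; rewrite truncnS_gt.
Unshelve. all: by end_near. Qed.

End NaturalRoot.

Lemma chain_matrixE (R : realType) (S : finType) (E : rel S)
    (lab : 'I_#|S| -> S) (mu : S -> R) (K : nat -> nat) (t : nat) :
    (0 < #|S|)%N ->
    (forall t, [/\ (0 < K t)%N, (K t ^ (5 * #|S|) <= maxn 1 t)%N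
                 & (t < (K t).+1 ^ (5 * #|S|))%N]) ->
  chain_matrix E lab mu t = target_matrix E lab (mu_ mu (K t)).
Proof.
move=> S0 KP; have e0 : (0 < 5 * #|S|)%N by rewrite muln_gt0.
have [K0 Kt tK] := KP t.
rewrite /chain_matrix; case: eqP => [t0|/eqP].
  suff -> : K t = 1%N by [].
  apply/eqP; rewrite eqn_leq K0 andbT -(leq_exp2r _ _ e0) exp1n.
  by rewrite (leq_trans Kt) // t0.
rewrite -lt0n => t0; have tE : maxn 1 t = t by apply/maxn_idPr.
rewrite tE in Kt.
(* A window containing t must have index [K t], so all other terms of the sum vanish. *)
rewrite -(@fsbig_widen _ _ _ _ [set K t]) /=; first 1 last.
- by move=> k ->.
- move=> k [/= k0 /eqP nk]; case: andP => [[k1 k2]|_]; last by rewrite scale0r.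
  case/negP: nk; rewrite eqn_leq (natural_root_le e0 KP) ?tE //=.
  by rewrite -ltnS -(ltn_exp2r _ _ e0) (leq_ltn_trans Kt).
by rewrite fsbig_set1 /epoch Kt tK scale1r.
Qed.

(** For K^q <= t < (K + 1)^q the value [u t] differs from that at K^q by at most (K + 1)^q - K^q.
    Divided by K^q this is (1 + 1 / K)^q - 1, which tends to 0. *)
Lemma cvg_power_subsequence (R : realType) (u : nat -> R) (q : nat) :
    (0 < q)%N ->
    (forall t, `|u t.+1 - u t| <= 1) ->
    (fun n => (n ^ q)%:R^-1 * u (n ^ q)%N) @ \oo --> (0 : R) ->
  (fun t => t%:R^-1 * u t) @ \oo --> (0 : R).
Proof.
move=> q0 u_lip u_sub; have [K KP] := natural_root q0.
have u_diff s r : `|u (s + r)%N - u s| <= r%:R.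
  elim: r => [|r IHr]; first by rewrite addn0 subrr normr0.
  rewrite addnS -[r.+1]addn1 natrD.
  have -> : u (s + r).+1 - u s = (u (s + r)%N - u s) +
    (u (s + r).+1 - u (s + r)%N) by ring.
  by apply: le_trans (ler_normD _ _) _; rewrite lerD.
have K_oo : K @ \oo --> \oo.
  apply/cvgnyPge => A; near=> t; apply: (natural_root_le q0 KP).
  by rewrite leq_max; apply/orP; right; near: t; exact: nbhs_infty_ge.
have lim1 : (fun t => `|(K t ^ q)%:R^-1 * u (K t ^ q)%N| +
    ((1 + (K t)%:R^-1) ^+ q - 1)) @ \oo --> (0 : R).
  rewrite -[X in _ --> X]addr0; apply: cvgD.
    rewrite -[X in _ --> X](@normr0 _ R); apply: cvg_norm.
    exact: (cvg_comp _ _ K_oo u_sub).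
  rewrite -[X in _ --> X](subrr 1); apply: cvgB; last exact: cvg_cst.
  have : (fun t => (1 + (K t)%:R^-1) ^+ q) @ \oo --> ((1 + 0) ^+ q : R).
    apply: (@continuous_cvg _ _ _ _ _ _ (fun x : R => x ^+ q)).
      exact: exprn_continuous.
    by apply: cvgD; [exact: cvg_cst|exact: (natural_root_cvg q0 KP)].
  by rewrite addr0 expr1n.
apply/norm_cvg0P; apply: (squeeze_cvgr _ (cvg_cst 0) lim1).
near=> t; rewrite normr_ge0 /=.
have [K0 Kt tK] := KP t.
have t0 : (0 < t)%N by near: t; exact: nbhs_infty_gt.
rewrite (maxn_idPr t0) in Kt.
have Kr0 : (0 : R) < (K t ^ q)%:R by rewrite ltr0n expn_gt0 K0.
have Krt : ((K t ^ q)%:R : R) <= t%:R by rewrite ler_nat.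
have tr0 : (0 : R) < t%:R by rewrite ltr0n.
have -> : (1 + (K t)%:R^-1) ^+ q - 1 =
    ((K t).+1 ^ q - K t ^ q)%N%:R / (K t ^ q)%:R :> R.
  rewrite natrB ?leq_exp2r // mulrBl divff ?lt0r_neq0 // !natrX -expr_div_n.
  by rewrite -[(K t).+1]addn1 natrD mulrDl divff ?div1r // pnatr_eq0 -lt0n.
have ut : `|u t| <= `|u (K t ^ q)%N| + ((K t).+1 ^ q - K t ^ q)%N%:R.
  have := u_diff (K t ^ q)%N (t - K t ^ q)%N; rewrite subnKC // => dif.
  have -> : u t = u (K t ^ q)%N + (u t - u (K t ^ q)%N) by ring.
  apply: le_trans (ler_normD _ _) _; rewrite lerD2l (le_trans dif) //.
  by rewrite ler_nat leq_sub2r // ltnW.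
rewrite !normrM !normfV !normr_nat [X in _ <= _ + X]mulrC -mulrDr.
by apply: ler_pM; rewrite ?invr_ge0 // lef_pV2.
Unshelve. all: by end_near. Qed.

(** Adding the boundary term [G (K m) (y m)] makes the partial sum constant as long as [K] is, so
    only jumps of [K] contribute. The invariant 2 C K^3 absorbs them, and removing the boundary term
    costs another C K^2, whence the factor 3. *)
Lemma telescoping_le (R : realType) (n : nat) (K : nat -> nat)
    (G : nat -> 'I_n -> R) (C : R) (y : nat -> 'I_n) (t : nat) :
    0 <= C -> (forall t, 0 < K t)%N -> {homo K : s t / (s <= t)%N} ->
    (forall k l, (0 < k)%N -> `|G k l| <= C * k%:R ^+ 2) ->
  `|\sum_(0 <= m < t) (G (K m) (y m) - G (K m) (y m.+1))| <=
    3 * C * (K t)%:R ^+ 3.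
Proof.
move=> C0 K0 Kh GC.
pose A t := \sum_(0 <= m < t) (G (K m) (y m) - G (K m) (y m.+1)).
rewrite -/(A t).
have K1 m : (1 : R) <= (K m)%:R by rewrite (ler_nat _ 1).
have key m : `|A m + G (K m) (y m)| <= 2 * C * (K m)%:R ^+ 3.
  elim: m => [|m IHm].
    rewrite /A big_nil add0r (le_trans (GC _ _ (K0 0%N))) //.
    have := K1 0%N; move: (K 0%N)%:R => a a1.
    rewrite [2 * C]mulrC -mulrA ler_wpM2l // exprS mulrA ler_peMl ?sqr_ge0 //.
    by lra.
  rewrite /A big_nat_recr //= -/(A m).
  have -> : A m + (G (K m) (y m) - G (K m) (y m.+1)) + G (K m.+1) (y m.+1) =
    A m + G (K m) (y m) + (G (K m.+1) (y m.+1) - G (K m) (y m.+1)) by ring.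
  have := Kh m m.+1 (leqnSn m); rewrite leq_eqVlt => /orP[/eqP <-|Klt].
    by rewrite subrr addr0.
  have KR : (K m)%:R + 1 <= (K m.+1)%:R :> R by rewrite natr1 ler_nat.
  have Gm := GC (K m) (y m.+1) (K0 m).
  have GS := GC (K m.+1) (y m.+1) (K0 m.+1).
  apply: le_trans (ler_normD _ _) _.
  apply: le_trans (lerD IHm (ler_normB _ _)) _.
  apply: le_trans (lerD (lexx _) (lerD GS Gm)) _.
  have := K1 m; move: (K m)%:R (K m.+1)%:R KR => a b ab a1.
  have -> : 2 * C * a ^+ 3 + (C * b ^+ 2 + C * a ^+ 2) =
    C * (2 * a ^+ 3 + b ^+ 2 + a ^+ 2) by ring.
  rewrite [2 * C]mulrC -mulrA ler_wpM2l //.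
  have a2b2 : a ^+ 2 <= b ^+ 2 by rewrite lerXn2r ?nnegrE //; lra.
  (* As b >= a + 1, this yields 2 a^3 <= 2 b^3 - 2 b^2, which leaves room for the cost a^2 + b^2 of
     the jump. *)
  have : a ^+ 3 <= (b - 1) * b ^+ 2.
    rewrite exprS; apply: ler_pM => //; rewrite ?sqr_ge0 //; lra.
  by rewrite [b ^+ 3]exprS; lra.
have -> : A t = A t + G (K t) (y t) - G (K t) (y t) by ring.
apply: le_trans (ler_normB _ _) _.
apply: le_trans (lerD (key t) (GC _ _ (K0 t))) _.
have := K1 t; move: (K t)%:R => a a1.
have -> : 2 * C * a ^+ 3 + C * a ^+ 2 = C * (2 * a ^+ 3 + a ^+ 2) by ring.
rewrite [3 * C]mulrC -mulrA ler_wpM2l //.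
have : 0 <= a ^+ 2 * (a - 1) by rewrite mulr_ge0 ?sqr_ge0 //; lra.
by rewrite [a ^+ 3]exprS; lra.
Qed.

Lemma cesaro_shift (R : realType) (u : nat -> R) (l : R) :
  u @ \oo --> l -> (fun t => t%:R^-1 * \sum_(0 <= m < t) u m) @ \oo --> l.
Proof. by move=> /cesaro ul; rewrite -cvg_shiftS. Qed.

(** * The chain on labels and the ergodic theorem *)

Lemma markov_labels (R : realType) (S : finType) (lab : 'I_#|S| -> S)
    (lab' : S -> 'I_#|S|) (lambda : S -> R) (d : measure_display)
    (Omega : measurableType d) (P : probability Omega R)
    (Q : nat -> 'M[R]_#|S|) (X : nat -> Omega -> S) :
    cancel lab lab' -> cancel lab' lab -> markov_chain P lab lambda Q X ->
  (forall t l, measurable [set w | lab' (X t w) = l]) /\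
  (forall t (x : {ffun 'I_t.+1 -> 'I_#|S|}) (m : 'I_#|S|),
    law P (fun w => (history (fun t w => lab' (X t w)) t w, lab' (X t.+1 w)))
      (x, m) =
    law P (history (fun t w => lab' (X t w)) t) x * Q t (x ord_max) m).
Proof.
move=> labK lab'K [X_meas _ X_markov]; set Y := fun t w => lab' (X t w).
have YE t l : [set w | Y t w = l] = [set w | X t w = lab l].
  by apply/seteqP; split=> w /=; rewrite /Y; [move=> <-|move=> ->].
have Y_meas t l : measurable [set w | Y t w = l] by rewrite YE; exact: X_meas.
split=> // t x m.
have := X_markov t (fun i => x (inord i)) m; cbv zeta.
have pastE : [set w | forall i, (i <= t)%N -> X i w = lab (x (inord i))] =
    history Y t @^-1` [set x].
  apply/seteqP; split=> w /=.
    move=> past; apply/ffunP => i; rewrite ffunE /Y past ?labK ?inord_val //.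
    by rewrite -ltnS.
  by move=> <- i it; rewrite ffunE inordK // /Y lab'K.
rewrite pastE -YE; set B := history Y t @^-1` _; set A := [set w | _].
have mB : measurable B by exact: history_measurable.
have mA : measurable A by exact: Y_meas.
have -> : law P (fun w => (history Y t w, Y t.+1 w)) (x, m) =
    fine (P (A `&` B)).
  congr (fine (P _)); apply/seteqP; split=> w /=.
    by move=> [hx hm]; split.
  by move=> [hm hx]; congr pair.
rewrite -[law _ _ x]/(fine (P B)).
have -> : x (inord t) = x ord_max.
  by congr (x _); apply: val_inj; rewrite /= inordK.
(* The Markov hypothesis is silent on histories of probability zero, but there both sides of the
   product form vanish. *)
have [B0 _|B0 /(_ isT)] := eqVneq (P B) 0%E.
  rewrite (@subset_measure0 _ _ _ P (A `&` B) B) //; first by rewrite B0 mul0r.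
  exact: measurableI.
rewrite /cond_prob => <-; rewrite mulrC divfK //.
by rewrite fine_eq0 // fin_num_measure.
Qed.

Theorem theorem2 (R : realType) (S : finType) (E : rel S) (mu : S -> R)
    (lab : 'I_#|S| -> S) (lambda : S -> R)
    (d : measure_display) (Omega : measurableType d)
    (P : probability Omega R) (X : nat -> Omega -> S)
    (hE : simple_graph E) (hconn : connected_graph E)
    (hmu : distribution_on mu)
    (hsupp : ~ connected_graph (induced_subgraph E (supp mu)))
    (hlab : bijective lab)
    (hlab_mu : forall l m : 'I_#|S|, (l <= m)%N -> mu (lab m) <= mu (lab l))
    (hlambda : distribution_on lambda)
    (hX : markov_chain P lab lambda (chain_matrix E lab mu) X) :
  {ae P, forall w, forall s : S,
     (fun t : nat => 1 / t%:R * \sum_(0 <= m < t) (X m w == s)%:R : R)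
       @ \oo --> mu s}.
Proof.
have [lab' labK lab'K] := hlab.
set N := #|S|; set Q := chain_matrix E lab mu.
have N2 : (1 < N)%N := card_gt1_of_disconnected hconn hmu hsupp.
have e0 : (0 < 5 * N)%N by rewrite muln_gt0 (ltnW N2).
have [K KP] := natural_root e0.
have K0 t : (0 < K t)%N by have [] := KP t.
have QE t : Q t = target_matrix E lab (mu_ mu (K t)).
  by apply: chain_matrixE; rewrite ?(ltnW N2).
(* The exponent 5N is at least 10 because N >= 2. *)
have K10 t : (K t ^ 10 <= maxn 1 t)%N.
  have [_ Kt _] := KP t; apply: leq_trans Kt; apply: leq_pexp2l => //.
  by rewrite (leq_mul2l 5 2).
(* Indeed (K^2)^5 = K^10 <= k^4 <= k^5. Martingale differences of size O(K^2) are therefore O(k)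
   before time k^4. *)
have K2 k t : (t < k ^ 4)%N -> (K t ^ 2 <= k)%N.
  move=> tk; have k0 : (0 < k)%N by case: k tk.
  rewrite -(leq_exp2r _ _ (isT : (0 < 5)%N)) -expnM.
  apply: leq_trans (K10 t) _; rewrite geq_max expn_gt0 k0 /=.
  by rewrite ltnW // (leq_trans tk) // leq_pexp2l.
have [Y_meas Y_markov] := markov_labels labK lab'K hX.
set Y := fun t w => lab' (X t w).
apply: filter_forall => s.
have nu_bounds t : 0 <= mu_ mu (K t) s <= 1.
  have nu_ge0 r : 0 <= mu_ mu (K t) r.
    apply: le_trans (perturbed_ge hconn hmu hsupp r (K0 t)).
    by rewrite invr_ge0 mulr_ge0.
  rewrite nu_ge0 /= -(perturbed_sum1 hconn hmu hsupp (K0 t)) (bigD1 s) //=.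
  rewrite lerDl.
  exact: sumr_ge0.
have dev_le1 (b : bool) t : `|b%:R - mu_ mu (K t) s| <= 1.
  have /andP[? ?] := nu_bounds t; rewrite ler_norml.
  by case: b => /=; apply/andP; split; lra.
set C : R := 4 * N%:R ^+ 3.
have C0 : 0 <= C by rewrite /C mulr_ge0 // exprn_ge0.
(* At k = 0 the function is a dummy; [K t] is always positive. *)
have /choice[G GP] : forall k, exists g : 'I_N -> R, (0 < k)%N ->
    (forall l, g l - \sum_m target_matrix E lab (mu_ mu k) l m * g m =
       (lab l == s)%:R - mu_ mu k s) /\
    (forall l, `|g l| <= C * k%:R ^+ 2).
  case=> [|k]; first by exists (fun _ => 0).
  by have [g gP] := perturbed_poisson hE hconn hmu hsupp s hlab (ltn0Sn k);
    exists g.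
(* The martingale difference: the value of [G (K t)] at the next state minus its conditional
   expectation. *)
pose D t l m := G (K t) m - \sum_m' Q t l m' * G (K t) m'.
have D_centred t l : \sum_m Q t l m * D t l m = 0.
  under eq_bigr do rewrite /D mulrBr.
  by rewrite sumrB -mulr_suml QE target_row_sum mul1r subrr.
have GE t l : \sum_m Q t l m * G (K t) m =
    G (K t) l - ((lab l == s)%:R - mu_ mu (K t) s).
  by rewrite QE -((GP _ (K0 t)).1 l) opprB addrC subrK.
have D_le k t l m : (t < k ^ 4)%N -> `|D t l m| <= (2 * C + 1) * k%:R.
  move=> /K2; rewrite -(ler_nat R) natrX => Kk.
  have K1 : (1 : R) <= (K t)%:R ^+ 2.
    by rewrite -natrX (ler_nat _ 1) expn_gt0 K0.
  have Gm := (GP _ (K0 t)).2 m; have Gl := (GP _ (K0 t)).2 l.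
  rewrite /D GE opprB addrCA addrC.
  apply: le_trans (ler_normD _ _) _.
  apply: le_trans (lerD (ler_normB _ _) (dev_le1 _ _)) _.
  have := ler_wpM2l C0 Kk; lra.
have := martingale_subsequence_cvg Y_meas Y_markov D_centred D_le.
apply: filterS => w Mcvg.
pose A t := \sum_(0 <= m < t) (G (K m) (Y m w) - G (K m) (Y m.+1 w)).
pose U t := \sum_(0 <= m < t) ((X m w == s)%:R - mu_ mu (K m) s).
(* By the Poisson equation each summand of [U] is G - QG at [Y m w]; the value of [G (K m)] at
   [Y m.+1 w] is subtracted in [A] and added in [D]. *)
have UE t : U t = A t + increments D t (Y ^~ w).
  rewrite /U /A /increments -big_split /=; apply: eq_bigr => m _.
  by rewrite /D GE lab'K; ring.
have A_cvg : (fun t => t%:R^-1 * A t) @ \oo --> (0 : R).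
  have lim0 : (fun t => 3 * C * (K t)%:R^-1) @ \oo --> (0 : R).
    rewrite -[X in _ --> X](mulr0 (3 * C)); apply: cvgM; first exact: cvg_cst.
    exact: (natural_root_cvg e0 KP).
  apply/norm_cvg0P; apply: (squeeze_cvgr _ (cvg_cst 0) lim0).
  near=> t; rewrite normr_ge0 /= normrM normfV normr_nat.
  have t0 : (0 < t)%N by near: t; exact: nbhs_infty_gt.
  have tr0 : (0 : R) < t%:R by rewrite ltr0n.
  have Kr0 : (0 : R) < (K t)%:R by rewrite ltr0n.
  have At := @telescoping_le R N K G C (Y ^~ w) t C0 K0
    (natural_root_homo e0 KP) (fun k l k0 => (GP k k0).2 l).
  rewrite mulrC ler_pdivrMr // (le_trans At) //.
  (* The bound 3 C K^3 / t is at most 3 C / K, since K^4 <= K^10 <= t. *)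
  rewrite -[leRHS]mulrA ler_wpM2l ?mulr_ge0 // ler_pdivlMl // -exprS.
  rewrite -natrX ler_nat; have := K10 t; rewrite (maxn_idPr t0).
  by apply: leq_trans; apply: leq_pexp2l.
have U_cvg : (fun t => t%:R^-1 * U t) @ \oo --> (0 : R).
  apply: (@cvg_power_subsequence R U 4) => // [t|].
    by rewrite /U big_nat_recr //= addrAC subrr add0r.
  have pow_ge k : (k <= k ^ 4)%N.
    by case: k => // k; rewrite -[X in (X <= _)%N]expn1 leq_pexp2l.
  have pow_oo : (fun k : nat => (k ^ 4)%N) @ \oo --> \oo.
    apply/cvgnyPge => a; near=> k; apply: leq_trans (pow_ge k).
    by near: k; exact: nbhs_infty_ge.
  have -> : (fun k => (k ^ 4)%:R^-1 * U (k ^ 4)%N) =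
      (fun t => t%:R^-1 * A t) \o (fun k => (k ^ 4)%N) +
      (fun k => (k ^ 4)%:R^-1 * increments D (k ^ 4) (Y ^~ w)).
    by apply/funext => k; rewrite UE mulrDr.
  have := cvgD (cvg_comp _ _ pow_oo A_cvg) Mcvg; rewrite addr0; exact.
have nu_cvg : (fun t => mu_ mu (K t) s) @ \oo --> mu s.
  apply/subr_cvg0/norm_cvg0P.
  apply: (squeeze_cvgr _ (cvg_cst 0) (@natural_root_cvg _ _ e0 KP R)); near=> t.
  by rewrite normr_ge0 (perturbed_close hconn hmu hsupp).
(* The centring subtracted in [U] is restored; its time average tends to [mu s] by Cesaro's
   theorem. *)
have -> : (fun t => 1 / t%:R * \sum_(0 <= m < t) (X m w == s)%:R) =
    (fun t => t%:R^-1 * U t + t%:R^-1 * \sum_(0 <= m < t) mu_ mu (K m) s).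
  apply/funext => t; rewrite -mulrDr div1r /U -big_split /=; congr (_ * _).
  by apply: eq_bigr => m _; rewrite subrK.
by rewrite -[X in _ --> X]add0r; apply: cvgD U_cvg (cesaro_shift nu_cvg).
Unshelve. all: by end_near. Qed.
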